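(* For any integers $n \geq 4$ and $\kappa_1 \geq \cdots \geq \kappa_n \geq 0$, the combinatorial diameter of the partition polytope $\mathrm{PP}(\kappa_1, \ldots, \kappa_n)$ is at least \[\left\lceil \frac{4(2\kappa_2 + 2\kappa_4 + \cdots + 2\kappa_n)}{3n} \right\rceil\] if $n$ is even (the sum being over all even indices from $2$ to $n$), and at least \[\left\lceil\frac{4(2\kappa_2 + 2\kappa_4 + \cdots + 2\kappa_{n-3} + 3\kappa_n)}{3n+1} \right\rceil\] if $n$ is odd (the terms with coefficient $2$ ranging over all even indices from $2$ to $n-3$).
   Context: For nonnegative integers $\kappa_1,\dots,\kappa_n$ with $m = \kappa_1+\cdots+\kappa_n$, the partition polytope $\mathrm{PP}(\kappa_1,\dots,\kappa_n)\subseteq\mathbb{R}^{nm}$ is the set of all real $n\times m$ matrices $(y_{ij})$ satisfying $\sum_{j=1}^m y_{ij}=\kappa_i$ for all $1\le i\le n$, $\sum_{i=1}^n y_{ij}=1$ for all $1\le j\le m$, and $y_{ij}\ge 0$ for all $i,j$. The (combinatorial) diameter of a polytope is the diameter of its edge graph, i.e. the graph whose vertices are the vertices of the polytope and whose edges are the one-dimensional faces of the polytope; the diameter of a connected graph is the maximum, over all pairs of vertices, of the length of a shortest path between them. *)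

(* Defs.v *)
From mathcomp Require Import all_boot all_order all_algebra.
From mathcomp Require Import boolp classical_sets reals.
Set Implicit Arguments.
Unset Strict Implicit.
Unset Printing Implicit Defensive.
Import Order.TTheory GRing.Theory Num.Theory.
Local Open Scope classical_set_scope.
Local Open Scope ring_scope.

Definition partition_polytope (R : realType) (n : nat) (kappa : 'I_n -> nat) :
    set 'M[R]_(n, \sum_(i < n) kappa i) :=
  [set y | [/\ forall i, \sum_j y i j = (kappa i)%:R,
               forall j, \sum_i y i j = 1
             & forall i j, 0 <= y i j]].

Section EdgeGraph.
Variables (R : realType) (V : vectType R).
Implicit Types (P F : set V) (u v : V).

(* P itself is a face (c = 0, b = 0). *)
Definition face P F : Prop :=
  exists (c : {scalar V}) (b : R),
    (forall x, P x -> c x <= b) /\ F = [set x | P x /\ c x = b].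

(* F is nonempty and its affine hull has dimension k: U is the smallest
   subspace containing all the differences x - x0 with x in F. *)
Definition affine_dim F (k : nat) : Prop :=
  exists (x0 : V) (U : {vspace V}),
    [/\ F x0,
        forall x, F x -> x - x0 \in U,
        forall W : {vspace V}, (forall x, F x -> x - x0 \in W) -> (U <= W)%VS
      & \dim U = k].

Definition vertex P v : Prop := face P [set v].

(* The vertices of P lying on a one-dimensional face are its two endpoints. *)
Definition adjacent P u v : Prop :=
  [/\ vertex P u, vertex P v, u <> v
    & exists F, [/\ face P F, affine_dim F 1, F u & F v]].

Definition walk P u v (k : nat) : Prop :=
  exists p : seq V,
    [/\ path (fun x y => `[< adjacent P x y >]) u p, last u p = v & size p = k].

Definition graph_dist P u v (k : nat) : Prop :=
  walk P u v k /\ forall l, walk P u v l -> (k <= l)%N.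

(* In particular the edge graph is nonempty and connected. *)
Definition diameter P (d : nat) : Prop :=
  (exists u v, [/\ vertex P u, vertex P v & graph_dist P u v d]) /\
  (forall u v, vertex P u -> vertex P v ->
     exists2 k, graph_dist P u v k & (k <= d)%N).

End EdgeGraph.

(* Main.v *)
Require Import Defs.
From HB Require Import structures.
From mathcomp Require Import all_boot all_order all_algebra all_fingroup.
From mathcomp Require Import boolp classical_sets reals.
From mathcomp Require Import zify ring lra.
Set Implicit Arguments.
Unset Strict Implicit.
Unset Printing Implicit Defensive.
Import Order.TTheory GRing.Theory Num.Theory.
Local Open Scope ring_scope.

(** The columns of a matrix are items and its rows are clusters, cluster [i]
    having [kappa i] places.  A vertex of the partition polytope is a
    clustering [f], a map from items to clusters that fills every cluster
    exactly ([vertex_cl], [vertex_cl_mx]).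

    An edge from [f] to [g] is a single cyclic exchange.  If some proper part
    of the moved items could be moved on its own, giving a clustering [h], then
    the rest could be too, giving [h'] with [h + h' = f + g]; so [h] would lie
    on the same edge off the line through [f] and [g]
    ([adjacent_exchange]).  Hence no proper part of the moved items is balanced, and
    in particular each cluster loses at most one item
    ([adjacent_moved_inj]).  Conversely the swap of two items is an edge
    ([swap_adjacent]), and swaps lead from any clustering to any other, so
    that distances are bounded and the diameter exists
    ([partition_diameter]).

    For the lower bound, cut the clusters into [n./2] consecutive blocks of
    size two, the last one having size three when [n] is odd, and let [tau]
    rotate each block.  In the target, as many items of each cluster [a] as the
    smallest cluster of its block contains must go from [a] to [tau a]; the
    other items stay put.  Such an item either makes the direct move from [a]
    to [tau a] or needs at least two moves.  Counting every move once, and every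
    direct move once more, each of these items costs at least [2].  On the
    other hand a step is cheap.  It moves at most [n] items, and if its direct
    moves do not exhaust a whole block then each block contains a cluster
    without direct move, so at most [n - n./2] moves are direct; if they do
    exhaust a block, then that block is the whole exchange, and the cost is at
    most [6].  For [4 <= n] a step therefore costs at most [2 * n - n./2]
    ([adjacent_cost]).  With [M] items to move this gives
    [2 * M <= d * (2 * n - n./2)] ([walk_potential]), and [2 * n - n./2] is
    half of [3 * n] or of [3 * n + 1] according to parity. *)

(** * Balanced weights on a bipartite graph without leaves *)

(** Fewer equations than unknowns: a homogeneous system has a nonzero solution.
    Unknowns and equations are subsets of finite types, so that the solution can
    be used as a function vanishing outside [E]. *)
Lemma kernel_on_sets (F : fieldType) (A B : finType) (E : {set A})
    (K : {set B}) (M : A -> B -> F) :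
  (#|K| < #|E|)%N ->
  exists w : A -> F, [/\ exists a, w a != 0, forall a, a \notin E -> w a = 0
    & forall b, b \in K -> \sum_a w a * M a b = 0].
Proof.
move=> ltKE.
pose N : 'M[F]_(#|E|, #|K|) := \matrix_(s, t) M (enum_val s) (enum_val t).
have : kermx N != 0.
  rewrite kermx_eq0 -row_leq_rank -ltnNge.
  exact: leq_ltn_trans (rank_leq_col N) ltKE.
case/rowV0Pn=> u /sub_kermxP uN0 /rV0Pn[s0 us0].
pose w a := \sum_(s | enum_val s == a) u 0 s.
have wE s : w (enum_val s) = u 0 s.
  by rewrite /w (eq_bigl (pred1 s)) ?big_pred1_eq // => t; rewrite (inj_eq enum_val_inj).
exists w; split.
- by exists (enum_val s0); rewrite wE.
- move=> a aE; rewrite /w big_pred0 // => s; apply: contraNF aE => /eqP <-.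
  exact: enum_valP.
move=> b bK; have := congr1 (fun X : 'rV_ _ => X 0 (enum_rank_in bK b)) uN0.
rewrite !mxE => sum0; rewrite -[RHS]sum0.
rewrite (bigID (mem E)) /= [X in _ + X]big1 ?addr0; last first.
  move=> a aE; rewrite /w big_pred0 ?mul0r // => s.
  by apply: contraNF aE => /eqP <-; exact: enum_valP.
rewrite big_enum_val; apply: eq_bigr => s _.
by rewrite wE mxE enum_rankK_in.
Qed.

Lemma scaling_below (R : realFieldType) (I : finType) (a b : I -> R) :
  (forall i, 0 <= a i) -> (forall i, a i = 0 -> b i = 0) ->
  exists2 e : R, 0 < e & forall i, `|e * b i| <= a i.
Proof.
move=> a0 ab; pose S := 1 + \sum_i `|b i| / a i.
have t0 i : 0 <= `|b i| / a i by rewrite divr_ge0.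
have S0 : 0 < S by rewrite ltr_pwDl // sumr_ge0.
(* All the ratios are at most [S], so [S^-1] is small enough for each index. *)
exists S^-1; first by rewrite invr_gt0.
move=> i; rewrite normrM gtr0_norm ?invr_gt0 // mulrC ler_pdivrMr //.
have [ai|ai] := eqVneq (a i) 0; first by rewrite ai ab // normr0 mul0r.
have ai0 : 0 < a i by rewrite lt_def ai a0.
rewrite mulrC -ler_pdivrMr // /S (bigD1 i) //= addrCA lerDl addr_ge0 //.
by rewrite sumr_ge0.
Qed.

Lemma second_nonint (R : archiNumDomainType) (I : finType) (x : I -> R) (i : I) :
  \sum_k x k \is a Num.int -> x i \isn't a Num.int ->
  exists2 k, k != i & x k \isn't a Num.int.
Proof.
move=> sx xi; apply/exists_inP; apply: contraNT xi => /exists_inPn /= h.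
have -> : x i = \sum_k x k - \sum_(k | k != i) x k.
  by rewrite (bigD1 i) //= addrK.
by rewrite rpredB // rpred_sum // => k ki; apply: negbNE (h k ki).
Qed.

Lemma sum_pair (V : nmodType) (I J : finType) (F : I * J -> V) :
  \sum_p F p = \sum_i \sum_j F (i, j).
Proof. by rewrite pair_bigA; apply: eq_bigr => -[]. Qed.

Lemma double_card_image_le (A B : finType) (p : A -> B) (E : {set A}) :
  (forall a, a \in E -> exists2 a', a' != a & (a' \in E) && (p a' == p a)) ->
  (2 * #|p @: E| <= #|E|)%N.
Proof.
move=> two; rewrite mulnC -sum_nat_const -[leqRHS]sum1_card.
rewrite (partition_big_imset p) /=; apply: leq_sum => _ /imsetP[a aE ->].
have [a' a'a /andP[a'E pa]] := two a aE.
by rewrite (bigD1 a) ?aE ?eqxx //= (bigD1 a') ?a'E ?pa //= addnA leq_addr.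
Qed.

(** Read [E] as the edges of a bipartite graph in which no vertex has degree one:
    such a graph contains a cycle, along which weights of alternating signs are
    balanced.  The proof counts instead of following the cycle: twice the number
    of edges is at least twice the number of rows plus twice the number of
    columns met by [E]. *)
Lemma balanced_weights (F : fieldType) (I J : finType) (E : {set I * J}) p0 :
  p0 \in E ->
  (forall p, p \in E -> exists2 j, j != p.2 & (p.1, j) \in E) ->
  (forall p, p \in E -> exists2 i, i != p.1 & (i, p.2) \in E) ->
  exists w : I * J -> F, [/\ exists p, w p != 0, forall p, p \notin E -> w p = 0,
    forall i, \sum_j w (i, j) = 0 & forall j, \sum_i w (i, j) = 0].
Proof.
case: p0 => i0 j0 p0E row2 col2.
have two1 : (2 * #|[set p.1 | p in E]| <= #|E|)%N.
  apply: double_card_image_le => -[i j] ijE; have [k kj kE] := row2 _ ijE.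
  by exists (i, k); rewrite ?xpair_eqE ?(negPf kj) ?andbF ?eqxx ?kE.
have two2 : (2 * #|[set p.2 | p in E]| <= #|E|)%N.
  apply: double_card_image_le => -[i j] ijE; have [k kj kE] := col2 _ ijE.
  by exists (k, j); rewrite ?xpair_eqE ?(negPf kj) ?eqxx ?kE.
have j0E : j0 \in [set p.2 | p in E] by apply/imsetP; exists (i0, j0).
(* One column equation is dropped: it follows from the others, since all the row
   sums and all the column sums have the same total, and without it there are
   strictly fewer equations than edges. *)
pose K : {set I + J} :=
  (inl @: [set p.1 | p in E]) :|: (inr @: ([set p.2 | p in E] :\ j0)).
have cK : (#|K| < #|E|)%N.
  apply: leq_ltn_trans (leq_card_setU _ _) _.
  apply: leq_ltn_trans (leq_add (leq_imset_card _ _) (leq_imset_card _ _)) _.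
  by have := cardsD1 j0 [set p.2 | p in E]; rewrite j0E; lia.
pose M (p : I * J) (k : I + J) : F :=
  match k with inl i => (p.1 == i)%:R | inr j => (p.2 == j)%:R end.
have [w [w0 wE wK]] := kernel_on_sets M cK.
have wrow i : \sum_j w (i, j) = 0.
  have [iE|iE] := boolP (i \in [set p.1 | p in E]).
    rewrite -[RHS](wK (inl i)); last by rewrite inE imset_f.
    rewrite sum_pair (bigD1 i) //= [X in _ + X]big1 ?addr0 => [|a /negPf ai].
      by apply: eq_bigr => j _; rewrite eqxx mulr1.
    by rewrite big1 // => j _; rewrite ai mulr0.
  apply: big1 => j _; apply: wE; apply: contra iE => ijE.
  by apply/imsetP; exists (i, j).
have wcol0 j : j != j0 -> \sum_i w (i, j) = 0.
  move=> jj0; have [jE|jE] := boolP (j \in [set p.2 | p in E]).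
    rewrite -[RHS](wK (inr j)); last by rewrite inE orbC imset_f // !inE jj0.
    rewrite sum_pair exchange_big (bigD1 j) //= [X in _ + X]big1 ?addr0 => [|b /negPf bj].
      by apply: eq_bigr => i _; rewrite eqxx mulr1.
    by rewrite big1 // => i _; rewrite bj mulr0.
  apply: big1 => i _; apply: wE; apply: contra jE => ijE.
  by apply/imsetP; exists (i, j).
exists w; split=> // j; have [->|] := eqVneq j j0; last exact: wcol0.
have : \sum_j \sum_i w (i, j) = 0 by rewrite exchange_big big1.
by rewrite (bigD1 j0) //= [X in _ + X]big1 ?addr0.
Qed.

(** * Vertices of the partition polytope *)

Section Polytope.
Variables (R : realType) (n : nat) (kappa : 'I_n -> nat).
Local Notation m := (\sum_(i < n) kappa i)%N.
Local Notation PP := (@partition_polytope R n kappa).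
Implicit Types (f g h : {ffun 'I_m -> 'I_n}) (x y : 'M[R]_(n, m)).

Definition clustering f := [forall i, #|[set j | f j == i]| == kappa i].

Definition cl_mx f : 'M[R]_(n, m) := \matrix_(i, j) (f j == i)%:R.

Lemma cl_mx_inj : injective cl_mx.
Proof.
move=> f g /matrixP fg; apply/ffunP => j; apply/eqP.
by have := fg (g j) j; rewrite !mxE eqxx; case: eqP => // _ /eqP; rewrite eq_sym oner_eq0.
Qed.

Lemma row_sum_cl f i : \sum_j cl_mx f i j = #|[set j | f j == i]|%:R.
Proof.
rewrite -sum1_card natr_sum [RHS]big_mkcond; apply: eq_bigr => j _.
by rewrite mxE inE; case: eqP.
Qed.

Lemma cl_mxP f : PP (cl_mx f) <-> clustering f.
Proof.
split=> [[rows _ _]|/forallP fP].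
  by apply/forallP=> i; rewrite -(eqr_nat R) -row_sum_cl rows.
split=> [i|j|i j]; first by rewrite row_sum_cl (eqP (fP i)).
- rewrite (bigD1 (f j)) //= mxE eqxx [X in _ + X]big1 ?addr0 // => i.
  by rewrite mxE eq_sym => /negPf ->.
- by rewrite mxE ler0n.
Qed.

(** The entries inside [S] of a point of the polytope sum to at most the number of
    items, with equality when all the entries outside [S] vanish; so this form
    exposes the points supported in [S] as a face. *)
Definition support_form (S : {set 'I_n * 'I_m}) x : R := \sum_(p in S) x p.1 p.2.

Lemma support_form_linear S : scalar (support_form S).
Proof.
move=> a x y; rewrite /support_form mulr_sumr -big_split /=.
by apply: eq_bigr => p _; rewrite !mxE.
Qed.

HB.instance Definition _ S :=
  GRing.isLinear.Build R 'M[R]_(n, m) R *%R (support_form S) (support_form_linear S).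

Lemma support_face (S : {set 'I_n * 'I_m}) :
  face PP [set x | PP x /\ forall p, p \notin S -> x p.1 p.2 = 0]%classic.
Proof.
have total x : PP x -> support_form S x + \sum_(p | p \notin S) x p.1 p.2 = m%:R.
  case=> _ cols _; transitivity (\sum_p x p.1 p.2); first by rewrite [RHS](bigID (mem S)).
  rewrite sum_pair exchange_big /=.
  by under eq_bigr do rewrite cols; rewrite sumr_const card_ord.
have rest0 x : PP x -> 0 <= \sum_(p | p \notin S) x p.1 p.2.
  by case=> _ _ pos; apply: sumr_ge0.
exists (support_form S : {scalar _}), m%:R; split=> /=.
  by move=> x Px; rewrite -(total x Px) lerDl rest0.
apply/seteqP; split=> x /= [Px xS]; split=> //.
  by rewrite -(total x Px) [X in _ = _ + X]big1 ?addr0.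
move/eqP: (total x Px); rewrite xS -subr_eq0 addrAC subrr add0r psumr_eq0.
  by move=> /allP h p pS; apply/eqP; have := h p (mem_index_enum _); rewrite pS.
by move=> p _; case: Px.
Qed.

Definition graph_of f : {set 'I_n * 'I_m} := [set p | f p.2 == p.1].

Lemma column_on f x j : PP x -> (forall i, i != f j -> x i j = 0) ->
  forall i, x i j = cl_mx f i j.
Proof.
case=> _ cols _ xf i; rewrite mxE eq_sym; case: eqVneq => [->|/xf //].
by have := cols j; rewrite (bigD1 (f j)) //= [X in _ + X]big1 ?addr0.
Qed.

Lemma vertex_cl_mx f : clustering f -> vertex PP (cl_mx f).
Proof.
move=> /cl_mxP Pf; have := support_face (graph_of f); rewrite /vertex.
congr face; apply/seteqP; split=> [x /= [Px xf]|x -> /=].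
  apply/matrixP=> i j; apply: column_on => // k kf.
  by apply: (xf (k, j)); rewrite inE eq_sym.
by split=> // p; rewrite inE mxE => /negPf ->.
Qed.

(** The form exposing [v] is at most its value at [v] on both sides of [v], so it
    is constant on the segment, which therefore lies in the exposed face. *)
Lemma vertex_extreme (P : set 'M[R]_(n, m)) v z :
  vertex P v -> P (v + z) -> P (v - z) -> z = 0.
Proof.
case=> c [b [le_b Pv]] Pp Pm.
have [_ cv] : P v /\ c v = b by have : [set v]%classic v by []; rewrite Pv.
have := le_b _ Pp; have := le_b _ Pm; rewrite linearB linearD /= cv => h1 h2.
have cz : c z = 0 by apply/eqP; rewrite eq_le; apply/andP; split; lra.
have : [set v]%classic (v + z) by rewrite Pv /= linearD /= cv cz addr0.
by move=> /= /eqP; rewrite -subr_eq0 addrAC subrr add0r => /eqP.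
Qed.

Lemma vertex_in (P : set 'M[R]_(n, m)) v : vertex P v -> P v.
Proof.
case=> c [b [_ Pv]].
by have : [set v]%classic v by []; rewrite Pv => -[].
Qed.

(** Row and column sums are integers, so a row or column with one non-integer
    entry has another one.  The non-integer entries thus carry balanced weights,
    and since those entries are not zero the vertex could be pushed a little
    both ways along these weights. *)
Lemma vertex_int v : vertex PP v -> forall i j, v i j \is a Num.int.
Proof.
move=> vV; have [rows cols pos] := vertex_in vV.
pose E : {set 'I_n * 'I_m} := [set p | v p.1 p.2 \isn't a Num.int].
suff E0 : E = finset.set0.
  by move=> i j; have := finset.in_set0 (i, j); rewrite -E0 inE => /negbFE.
apply: contraPeq vV => /finset.set0Pn[[i0 j0] Ep0] vV.
have [||w [[p0 wp0] wE wrow wcol]] := @balanced_weights R _ _ E (i0, j0) Ep0.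
- move=> [i j]; rewrite inE /= => vij.
  have [|k kj vk] := second_nonint (x := v i) _ vij; first by rewrite rows.
  by exists k => //; rewrite inE.
- move=> [i j]; rewrite inE /= => vij.
  have [|k kj vk] := second_nonint (x := v^~ j) _ vij; first by rewrite cols.
  by exists k => //; rewrite inE.
have [|p vp0|e e0 ew] := @scaling_below R _ (fun p => v p.1 p.2) w.
- by move=> p; apply: pos.
- by apply: wE; rewrite inE vp0 negbK rpred0.
pose z : 'M[R]_(n, m) := \matrix_(i, j) (e * w (i, j)).
have PPz s : `|s| <= 1 -> PP (v + s *: z).
  move=> s1; split=> [i|j|i j].
  - rewrite (eq_bigr (fun j => v i j + s * e * w (i, j))) => [|j _]; last by rewrite !mxE mulrA.
    by rewrite big_split /= rows -mulr_sumr wrow mulr0 addr0.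
  - rewrite (eq_bigr (fun i => v i j + s * e * w (i, j))) => [|i _]; last by rewrite !mxE mulrA.
    by rewrite big_split /= cols -mulr_sumr wcol mulr0 addr0.
  rewrite !mxE -lerBlDr sub0r; apply: le_trans (ew (i, j)).
  by rewrite (le_trans (ler_norm _)) // normrN normrM ler_piMl.
have /matrixP/(_ p0.1 p0.2) : z = 0.
  apply: (vertex_extreme vV); first by rewrite -[z]scale1r; apply: PPz; rewrite normr1.
  by rewrite -scaleN1r; apply: PPz; rewrite normrN1.
by rewrite !mxE -surjective_pairing => /eqP; rewrite mulf_eq0 (negPf wp0) gt_eqF.
Qed.

Lemma vertex_cl v : vertex PP v -> exists2 f, clustering f & v = cl_mx f.
Proof.
move=> vV; have vint := vertex_int vV; have Pv := vertex_in vV.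
have [rows cols pos] := Pv.
have colP j : exists i, v i j != 0.
  apply/existsP; apply: contraNT (oner_neq0 R) => /existsPn v0.
  by rewrite -(cols j) big1 // => i _; apply/eqP; have := v0 i; rewrite negbK.
pose f := [ffun j => xchoose (colP j)].
suff vf : v = cl_mx f by exists f => //; apply/cl_mxP; rewrite -vf.
apply/matrixP=> i j; apply: column_on => // k kf.
have fj : 1 <= v (f j) j.
  rewrite -[leRHS]ger0_norm //; apply: norm_intr_ge1 => //.
  by rewrite ffunE; apply: (xchooseP (colP j)).
apply/eqP; rewrite eq_le pos andbT.
have := cols j; rewrite (bigD1 (f j)) //= [X in _ + X](bigD1 k) //=.
have := @sumr_ge0 R _ (index_enum 'I_n) (fun i => (i != f j) && (i != k)) (v^~ j)
  (fun i _ => pos i j).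
lra.
Qed.
End Polytope.

(** * Distances in an edge graph *)

Section EdgeGraphTheory.
Variables (R : realType) (V : vectType R) (P : set V).

Lemma walk_cat u v w k l : walk P u v k -> walk P v w l -> walk P u w (k + l).
Proof.
case=> p [up pv <-] [q [vq qw <-]]; exists (p ++ q).
by rewrite cat_path last_cat pv up vq qw size_cat.
Qed.

Lemma walk_dist u v k : walk P u v k -> exists2 l, graph_dist P u v l & (l <= k)%N.
Proof.
move=> uvk; have ex : exists l, `[< walk P u v l >] by exists k; apply/asboolP.
case: (ex_minnP ex) => l /asboolP uvl lmin.
exists l; last exact/lmin/asboolP.
by split=> // l' uvl'; apply/lmin/asboolP.
Qed.

Lemma diameter_exists N u0 :
  vertex P u0 ->
  (forall u v, vertex P u -> vertex P v -> exists2 k, walk P u v k & (k <= N)%N) ->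
  exists d, diameter P d.
Proof.
move=> u0V walks.
pose realised d := exists u v, [/\ vertex P u, vertex P v & graph_dist P u v d].
have ex : exists d, `[< realised d >].
  have [k uk _] := walks _ _ u0V u0V; have [l ul _] := walk_dist uk.
  by exists l; apply/asboolP; exists u0, u0.
have bound d : `[< realised d >] -> (d <= N)%N.
  move=> /asboolP[u [v [uV vV [_ dmin]]]].
  by have [k uvk kN] := walks _ _ uV vV; apply: leq_trans kN; apply: dmin.
case: (ex_maxnP ex bound) => d /asboolP dr dmax.
exists d; split=> // u v uV vV; have [k uvk _] := walks _ _ uV vV.
have [l uvl _] := walk_dist uvk; exists l => //; apply/dmax/asboolP.
by exists u, v.
Qed.
End EdgeGraphTheory.

(** * Edges of the partition polytope *)

(** A matrix with zero row and column sums that lives on a 2 x 2 rectangle is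
    determined by one of its entries. *)
Lemma rectangle0 (V : nmodType) p q (y : 'M[V]_(p, q)) a b j1 j2 :
  (forall i, \sum_j y i j = 0) -> (forall j, \sum_i y i j = 0) ->
  a != b -> j1 != j2 ->
  (forall i j, ~~ ((i \in [:: a; b]) && (j \in [:: j1; j2])) -> y i j = 0) ->
  y b j1 = 0 -> y = 0.
Proof.
move=> rows cols ab j12 yrect yb1.
have col j : y a j + y b j = 0.
  rewrite -[RHS](cols j) (bigD1 a) //= [X in _ = _ + X](bigD1 b) 1?eq_sym //=.
  rewrite [X in _ + (_ + X)]big1 ?addr0 // => i /andP[ia ib].
  by apply: yrect; rewrite !inE (negPf ia) (negPf ib).
have ya1 : y a j1 = 0 by have := col j1; rewrite yb1 addr0.
have ya2 : y a j2 = 0.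
  have := rows a; rewrite (bigD1 j1) //= [X in _ + X](bigD1 j2) 1?eq_sym //= ya1 add0r.
  rewrite [X in _ + X]big1 ?addr0 // => j /andP[jj1 jj2].
  by apply: yrect; rewrite !inE (negPf jj1) (negPf jj2) andbF.
have yb2 : y b j2 = 0 by have := col j2; rewrite ya2 add0r.
apply/matrixP=> i j; rewrite mxE.
have [|] := boolP ((i \in [:: a; b]) && (j \in [:: j1; j2])); last exact: yrect.
by rewrite !inE => /andP[/pred2P[]-> /pred2P[]->].
Qed.

Section Adjacency.
Variables (R : realType) (n : nat) (kappa : 'I_n -> nat).
Local Notation m := (\sum_(i < n) kappa i)%N.
Local Notation PP := (@partition_polytope R n kappa).
Local Notation cl_mx := (@cl_mx R n kappa).
Implicit Types (f g h : {ffun 'I_m -> 'I_n}) (x y : 'M[R]_(n, m)).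

Definition reseat f (s : {perm 'I_m}) : {ffun 'I_m -> 'I_n} := [ffun j => f (s j)].

Lemma clustering_reseat f s : clustering f -> clustering (reseat f s).
Proof.
move=> /forallP fP; apply/forallP=> i; rewrite -(eqP (fP i)).
rewrite -[X in _ == X](card_preimset _ (@perm_inj _ s)).
by apply/eqP/eq_card=> j; rewrite !inE ffunE.
Qed.

(** The edge is the face of the points supported where [f] or its swap is.  Such a
    point differs from [f] only on the rectangle spanned by the two items and
    the two clusters, so it is determined by one entry. *)
Lemma swap_adjacent f j1 j2 : clustering f -> f j1 != f j2 ->
  adjacent PP (cl_mx f) (cl_mx (reseat f (tperm j1 j2))).
Proof.
move=> fC f12; have j12 : j1 != j2 by apply: contraNneq f12 => ->.
set g := reseat _ _; have gC : clustering g by apply: clustering_reseat.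
have g1 : g j1 = f j2 by rewrite ffunE tpermL.
have g2 : g j2 = f j1 by rewrite ffunE tpermR.
have gD j : j != j1 -> j != j2 -> g j = f j.
  by move=> ? ?; rewrite ffunE tpermD // eq_sym.
have fg : cl_mx f <> cl_mx g.
  by move=> /cl_mx_inj fg; move: f12; rewrite {1}fg g1 eqxx.
have Pf := proj2 (cl_mxP R f) fC; have Pg := proj2 (cl_mxP R g) gC.
split=> //; do ?exact: vertex_cl_mx.
have := support_face R (graph_of f :|: graph_of g).
set F := (X in face _ X) => faceF; exists F.
have Ff : F (cl_mx f).
  by split=> // p; rewrite !inE mxE => /norP[/negPf->].
have Fg : F (cl_mx g).
  by split=> // p; rewrite !inE mxE => /norP[_ /negPf->].
split=> //; exists (cl_mx f), <[cl_mx g - cl_mx f]>%VS; split=> //.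
- move=> x [Px xS]; apply/vlineP; exists (x (f j2) j1); apply/eqP.
  rewrite -subr_eq0; apply/eqP; set t := x _ _.
  have [[xr xc _] [fr fc _] [gr gc _]] := And3 Px Pf Pg.
  have yE (A C : 'M_(n, m)) i j :
      fun_of_matrix (x - A - t *: (C - A) : 'M[R]_(n, m)) i j = x i j - A i j - t * (C i j - A i j).
    by rewrite !mxE.
  apply: (rectangle0 (a := f j1) (b := f j2) (j1 := j1) (j2 := j2)) => //.
  + move=> i; rewrite (eq_bigr (fun j => x i j - cl_mx f i j - t * (cl_mx g i j - cl_mx f i j))).
      by rewrite !(sumrB, =^~ mulr_sumr) xr fr gr; ring.
    by move=> j _; rewrite yE.
  + move=> j; rewrite (eq_bigr (fun i => x i j - cl_mx f i j - t * (cl_mx g i j - cl_mx f i j))).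
      by rewrite !(sumrB, =^~ mulr_sumr) xc fc gc; ring.
    by move=> i _; rewrite yE.
  + move=> i j; rewrite !inE; have [|/norP[jj1 jj2] _] := boolP ((j == j1) || (j == j2)).
      move=> jj iab; have [fi gi] : (f j == i) = false /\ (g j == i) = false.
        move: iab; rewrite andbT => /norP[/negPf ia /negPf ib].
        by case/pred2P: jj => ->; rewrite ?g1 ?g2 ![_ == i]eq_sym.
      rewrite !mxE fi gi subrr mulr0 !subr0.
      by apply: (xS (i, j)); rewrite !inE /= fi gi.
    rewrite !mxE gD // subrr mulr0 subr0.
    rewrite (@column_on _ _ _ f _ j Px) ?mxE ?subrr // => k kf.
    by apply: (xS (k, j)); rewrite !inE /= gD // orbb eq_sym.
  by rewrite !mxE g1 eqxx (negPf f12) !subr0 mulr1 subrr.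
- by move=> W WF; rewrite -memvE; apply: WF.
by rewrite dim_vline subr_eq0; case: eqP => // fg'; case: fg; rewrite fg'.
Qed.

Definition exchange (D : {set 'I_m}) f g : {ffun 'I_m -> 'I_n} :=
  [ffun j => if j \in D then g j else f j].

Lemma clustering_rows f :
  (forall i, \sum_j cl_mx f i j = (kappa i)%:R) -> clustering f.
Proof.
by move=> rows; apply/forallP=> i; rewrite -(eqr_nat R) -row_sum_cl rows.
Qed.

(** Moving only the items of [D], or only the others, gives two points whose
    midpoint is that of the edge, so both lie on the edge; but a point of the
    line through [f] and [g] that agrees with [g] on a moved item is [g]. *)
Lemma adjacent_exchange D f g :
  adjacent PP (cl_mx f) (cl_mx g) -> clustering (exchange D f g) ->
  (exists2 j, j \in D & f j != g j) -> exchange D f g = g.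
Proof.
case=> fV gV _ [F [[c [b [le_b FE]]] [x0 [U [Fx0 FU _ dimU]]] Ff Fg]] hC [j jD fgj].
set h := exchange D f g in hC *; pose h' := exchange (~: D) f g.
have [fr _ _] := vertex_in fV; have [gr _ _] := vertex_in gV.
have Ph := proj2 (cl_mxP R h) hC; have [hr _ _] := Ph.
have sumE : cl_mx h + cl_mx h' = cl_mx f + cl_mx g.
  apply/matrixP=> i k; rewrite !mxE !ffunE finset.inE.
  by case: (k \in D) => //=; rewrite addrC.
have Ph' : PP (cl_mx h').
  apply/cl_mxP/clustering_rows=> i.
  rewrite (eq_bigr (fun k => cl_mx f i k + cl_mx g i k - cl_mx h i k)).
    by rewrite sumrB big_split /= fr gr hr addrK.
  move=> k _; have /matrixP/(_ i k) := sumE; rewrite !mxE => <-.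
  by rewrite addrAC subrr add0r.
have cF y : F y -> c y = b by rewrite FE => -[].
have Fh : F (cl_mx h).
  rewrite FE; split=> //; apply/eqP; rewrite eq_le le_b //=.
  have := le_b _ Ph'; have := congr1 c sumE; rewrite !linearD /= (cF _ Ff) (cF _ Fg).
  lra.
have UE y : F y -> y - cl_mx f \in U.
  move=> Fy; have -> : y - cl_mx f = (y - x0) - (cl_mx f - x0) by rewrite opprB addrA subrK.
  by rewrite memvB ?FU.
have fg : cl_mx g - cl_mx f != 0.
  rewrite subr_eq0; apply: contraNneq fgj => /cl_mx_inj ->; exact: eqxx.
have lineE : (<[cl_mx g - cl_mx f]> == U)%VS.
  by rewrite eqEdim -memvE UE // dimU dim_vline fg.
have := UE _ Fh; rewrite -(eqP lineE) => /vlineP[t /matrixP ht].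
have t1 : t = 1.
  have := ht (g j) j; rewrite !mxE !ffunE jD eqxx (negPf fgj) !subr0 mulr1.
  by move=> <-.
apply: (@cl_mx_inj R); apply/matrixP=> i k.
have := ht i k; rewrite t1 !mxE mul1r; apply: addIr.
Qed.

Lemma card_fibre_inj (D : {set 'I_m}) f i :
  {in D &, injective f} -> #|D :&: [set j | f j == i]| = (i \in f @: D).
Proof.
move=> finj; have [/imsetP[j jD ->]|iD] := boolP (i \in f @: D).
  apply/eqP/cards1P; exists j; apply/finset.setP=> k; rewrite !finset.inE.
  apply/andP/eqP=> [[kD /eqP/finj->//]|->//].
apply/eqP; rewrite cards_eq0; apply/eqP/finset.setP=> k; rewrite !finset.inE.
by apply: contraNF iD => /andP[kD /eqP<-]; rewrite imset_f.
Qed.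

(** Each cluster that loses an item of [D] gets exactly one item of [D] back. *)
Lemma clustering_exchange (D : {set 'I_m}) f g : clustering f ->
  {in D &, injective f} -> {in D &, injective g} -> f @: D = g @: D ->
  clustering (exchange D f g).
Proof.
move=> /forallP fC finj ginj fgD; apply/forallP=> i; rewrite -(eqP (fC i)).
rewrite -(cardsID D) -[X in _ == X](cardsID D) ![_ :&: D]finset.setIC.
have -> : D :&: [set j | exchange D f g j == i] = D :&: [set j | g j == i].
  by apply/finset.setP=> j; rewrite !finset.inE ffunE; case: (j \in D).
rewrite !card_fibre_inj // fgD eqn_add2l; apply/eqP/eq_card=> j.
by rewrite !finset.inE ffunE; case: (j \in D).
Qed.

Definition moved f g := [set j | f j != g j].

(** The cluster [g j] gains [j], so it must lose some item. *)
Lemma refill f g j : clustering f -> clustering g -> j \in moved f g ->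
  exists2 k, k \in moved f g & f k = g j.
Proof.
move=> /forallP/(_ (g j))/eqP fC /forallP/(_ (g j))/eqP gC; rewrite finset.inE => fgj.
suff /existsP[k /andP[fk gk]] : [exists k, (f k == g j) && (g k != g j)].
  by exists k; [rewrite finset.inE (eqP fk) eq_sym | exact/eqP].
apply: contraNT fgj => /existsPn stay.
have sub : [set k | f k == g j] \subset [set k | g k == g j].
  apply/fintype.subsetP=> k; rewrite !finset.inE => fk; have := stay k.
  by rewrite fk negbK.
have := subset_leqif_cards sub; rewrite fC gC => /leqif_refl /eqP/finset.setP/(_ j).
by rewrite !finset.inE eqxx.
Qed.

(** Choose one moved item [s a] in each cluster [a] that loses one, and send [a] to
    the destination of [s a].  A minimal nonempty set [O] of clusters closed
    under this map is permuted by it, so the items chosen in [O] form a balanced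
    exchange; by [adjacent_exchange] they are all the moved items. *)
Lemma adjacent_moved_inj f g : adjacent PP (cl_mx f) (cl_mx g) ->
  {in moved f g &, injective f}.
Proof.
move=> adj; have [/vertex_in/cl_mxP fC /vertex_in/cl_mxP gC fg _] := adj.
set D := moved f g.
have [j0 j0D] : exists j, j \in D.
  apply/finset.set0Pn; apply: contra_not_neq fg => D0; congr cl_mx; apply/ffunP=> j.
  by have := finset.in_set0 j; rewrite -D0 finset.inE => /negbFE/eqP.
pose s a := odflt j0 [pick j in D | f j == a].
have sP a : a \in f @: D -> s a \in D /\ f (s a) = a.
  move=> /imsetP[j jD ->]; rewrite /s; case: pickP => [k /andP[kD /eqP]//|/(_ j)].
  by rewrite jD eqxx.
pose next a := g (s a).
pose closed (O : {set 'I_n}) :=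
  [&& O != finset.set0, O \subset f @: D & next @: O \subset O].
have /minset_exists[O /minsetP[/and3P[O0 OV nextO] Omin] _] : closed (f @: D).
  apply/and3P; split=> //.
    by apply/finset.set0Pn; exists (f j0); rewrite imset_f.
  apply/fintype.subsetP=> _ /imsetP[a /sP[saD fsa] ->].
  by have [k kD fk] := refill fC gC saD; rewrite /next -fk imset_f.
have nextOE : next @: O = O.
  apply: Omin => //; apply/and3P; split; last exact: imsetS.
  - by rewrite imset_eq0.
  - exact: fintype.subset_trans nextO OV.
have sO a : a \in O -> s a \in D /\ f (s a) = a by move/(fintype.subsetP OV)/sP.
pose D' := s @: O.
have fD' : f @: D' = O.
  rewrite -imset_comp -[RHS]imset_id; apply: eq_in_imset => a /sO[_ /= ->].
  by [].
have gD' : g @: D' = O by rewrite -imset_comp -[RHS]nextOE.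
have le_D' : (#|D'| <= #|O|)%N by apply: leq_imset_card.
have finj : {in D' &, injective f} by apply/imset_injP; rewrite eqn_leq leq_imset_card fD'.
have ginj : {in D' &, injective g} by apply/imset_injP; rewrite eqn_leq leq_imset_card gD'.
have hg : exchange D' f g = g.
  apply: adjacent_exchange => //; first by apply: clustering_exchange => //; rewrite fD' gD'.
  have /finset.set0Pn[a aO] := O0; exists (s a); first exact: imset_f.
  by have [] := sO a aO; rewrite finset.inE.
have DD' : D \subset D'.
  apply/fintype.subsetP=> j; rewrite finset.inE; apply: contraNT => jD'.
  by rewrite -[in X in _ == X]hg ffunE (negPf jD').
by move=> j k /(fintype.subsetP DD') jD' /(fintype.subsetP DD') kD'; apply: finj.
Qed.

End Adjacency.

(** * Connectivity and the cost of a step *)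

Section Connected.
Variables (R : realType) (n : nat) (kappa : 'I_n -> nat).
Local Notation m := (\sum_(i < n) kappa i)%N.
Local Notation PP := (@partition_polytope R n kappa).
Local Notation cl_mx := (@cl_mx R n kappa).
Implicit Types (f g h : {ffun 'I_m -> 'I_n}).

(** A moved item [j] is swapped with an item that has to leave the destination of
    [j]: this settles [j] and unsettles no item. *)
Lemma clusterings_connected f g : clustering f -> clustering g ->
  exists2 k, walk PP (cl_mx f) (cl_mx g) k & (k <= #|moved f g|)%N.
Proof.
move=> fC gC; have [N] := ubnP #|moved f g|.
elim: N f fC => // N IH f fC; rewrite ltnS => leN.
have [fg0|/finset.set0Pn[j jfg]] := eqVneq (moved f g) finset.set0.
  have -> : f = g.
    apply/ffunP=> j; have := finset.in_set0 j.
    by rewrite -fg0 finset.inE => /negbFE/eqP.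
  by exists 0%N => //; exists [::].
have [k kfg fkgj] := refill fC gC jfg.
pose f' := reseat f (tperm j k); have f'C : clustering f' := clustering_reseat _ fC.
have lt_f' : (#|moved f' g| < #|moved f g|)%N.
  apply: proper_card; apply/properP; split; last first.
    by exists j => //; rewrite finset.inE ffunE tpermL fkgj eqxx.
  apply/fintype.subsetP=> l; rewrite [l \in moved f' g]finset.inE ffunE.
  by case: tpermP => [->|->|_ _] //; rewrite finset.inE.
have [l f'gl lel] := IH _ f'C (leq_trans lt_f' leN).
exists (1 + l)%N; last exact: leq_ltn_trans lel lt_f'.
apply: walk_cat f'gl; exists [:: cl_mx f']; split=> //=; rewrite andbT.
apply/asboolP/swap_adjacent => //.
by rewrite fkgj; move: jfg; rewrite finset.inE.
Qed.

Lemma partition_diameter f : clustering f -> exists d, diameter PP d.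
Proof.
move=> fC; apply: (@diameter_exists R _ PP m (cl_mx f)); first exact: vertex_cl_mx.
move=> _ _ /vertex_cl[g gC ->] /vertex_cl[h hC ->].
have [k ghk lek] := clusterings_connected gC hC; exists k => //.
by apply: leq_trans lek _; rewrite -[leqRHS]card_ord max_card.
Qed.

Section Potential.
Variables (h : nat) (tau : 'I_n -> 'I_n) (beta : 'I_n -> 'I_h).
Hypothesis tau_inj : injective tau.
Hypothesis tau_neq : forall a, tau a != a.
Hypothesis beta_tau : forall a, beta (tau a) = beta a.
Hypothesis block_card : forall b, (0 < #|[set a | beta a == b]| <= 3)%N.
Hypothesis h_small : (6 + h <= 2 * n)%N.

Definition direct f g := [set j | g j == tau (f j)].

(** If the direct moves exhaust a block, they form a balanced exchange, which by
    [adjacent_exchange] is the whole step: at most three moves, all of them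
    direct.  Otherwise every one of the [h] blocks has a cluster that makes no
    direct move. *)
Lemma adjacent_cost f g : adjacent PP (cl_mx f) (cl_mx g) ->
  (#|moved f g| + #|direct f g| + h <= 2 * n)%N.
Proof.
move=> adj; have [/vertex_in/cl_mxP fC /vertex_in/cl_mxP gC _ _] := adj.
have finj := adjacent_moved_inj adj.
have dm : direct f g \subset moved f g.
  by apply/fintype.subsetP=> j; rewrite !finset.inE => /eqP->; rewrite eq_sym.
have finjd : {in direct f g &, injective f}.
  by move=> j k /(fintype.subsetP dm) jm /(fintype.subsetP dm) km; apply: finj.
have [/existsP[b bfull]|/existsPn open] :=
  boolP [exists b, [set a | beta a == b] \subset f @: direct f g].
  pose D := direct f g :&: [set j | beta (f j) == b].
  have fD : f @: D = [set a | beta a == b].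
    apply/finset.setP=> a; rewrite finset.inE; apply/imsetP/idP=> [[j]|ab].
      by rewrite !finset.inE => /andP[_ jb] ->.
    have /imsetP[j jd aE] : a \in f @: direct f g.
      by rewrite (fintype.subsetP bfull) ?finset.inE.
    by exists j => //; rewrite finset.inE jd finset.inE -aE.
  have Dd j : j \in D -> j \in direct f g by rewrite finset.inE => /andP[].
  have gD : g @: D = tau @: (f @: D).
    rewrite -imset_comp; apply: eq_in_imset => j /Dd.
    by rewrite finset.inE => /eqP.
  have tauB : tau @: [set a | beta a == b] = [set a | beta a == b].
    apply/eqP; rewrite eqEcard card_imset // leqnn andbT.
    by apply/fintype.subsetP=> _ /imsetP[a aB ->]; move: aB; rewrite !finset.inE beta_tau.
  have fDinj : {in D &, injective f} by move=> j k /Dd jD /Dd kD; apply: finjd.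
  have gDinj : {in D &, injective g}.
    by apply/imset_injP; rewrite gD card_imset //; apply/imset_injP.
  have /andP[B0 B3] := block_card b.
  have hg : exchange D f g = g.
    apply: adjacent_exchange adj _ _.
      by apply: clustering_exchange; rewrite // gD fD tauB.
    have : (0 < #|D|)%N by move/imset_injP: fDinj => /eqP <-; rewrite fD.
    case/card_gt0P=> j jD; exists j => //.
    by have := fintype.subsetP dm _ (Dd _ jD); rewrite finset.inE.
  have mD : moved f g \subset D.
    apply/fintype.subsetP=> j; rewrite finset.inE; apply: contraNT => jD.
    by rewrite -[in X in _ == X]hg ffunE (negPf jD).
  have := subset_leq_card mD; have := subset_leq_card dm.
  by move/imset_injP: fDinj => /eqP; rewrite fD; lia.
have lem : (#|moved f g| <= n)%N.
  by move/imset_injP: finj => /eqP <-; rewrite -[leqRHS]card_ord max_card.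
have missP b : exists a, (beta a == b) && (a \notin f @: direct f g).
  have /subsetPn[a] := open b; rewrite finset.inE => ab af.
  by exists a; rewrite ab af.
pose miss b := xchoose (missP b).
have missB b : beta (miss b) = b by have /andP[/eqP] := xchooseP (missP b).
have missN b : miss b \notin f @: direct f g by have /andP[] := xchooseP (missP b).
suff : (#|direct f g| + h <= n)%N by lia.
have disj : [disjoint f @: direct f g & [set miss b | b in 'I_h]].
  rewrite disjoint_sym; apply/pred0P=> a /=; apply/andP=> -[/imsetP[b _ ->]].
  by apply/negP.
move: disj; rewrite -leq_card_setU => /eqP.
have -> : #|f @: direct f g| = #|direct f g| by apply/eqP/imset_injP.
rewrite card_imset; last by move=> b c bc; rewrite -[b]missB bc missB.
by rewrite card_ord => <-; rewrite -[leqRHS]card_ord max_card.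
Qed.

(** The least cost of bringing an item from cluster [a] to cluster [t], when a move
    along [tau] costs [2] and any other move costs [1]: from [a] to [tau a] the item
    pays [2] for the direct move, and at least [2] for any detour. *)
Definition pot (a t : 'I_n) : nat := if a == t then 0 else if tau a == t then 2 else 1.

Lemma pot_step a a' t : (pot a t <= pot a' t + (a != a') + (a' == tau a))%N.
Proof.
rewrite /pot; have [<-|aa'] := eqVneq a a'; first by rewrite addn0 leq_addr.
case: eqVneq => // at'; have [<-|a't] := eqVneq a' t; first by rewrite eq_sym; case: eqP.
by do 2?case: ifP.
Qed.

Definition potential f g := (\sum_j pot (f j) (g j))%N.

Lemma potential_step f f' g : adjacent PP (cl_mx f) (cl_mx f') ->
  (potential f g <= potential f' g + (2 * n - h))%N.
Proof.
move=> adj; have cost := adjacent_cost adj.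
apply: (@leq_trans (potential f' g + (#|moved f f'| + #|direct f f'|))); last first.
  by rewrite leq_add2l; lia.
have cardE' (A : {set 'I_m}) : #|A| = (\sum_j (j \in A))%N.
  by rewrite -sum1_card big_mkcond.
rewrite !cardE' -!big_split /=; apply: leq_sum => j _.
by rewrite addnA !finset.inE; apply: pot_step.
Qed.

Lemma walk_potential f g k : walk PP (cl_mx f) (cl_mx g) k ->
  (potential f g <= k * (2 * n - h))%N.
Proof.
case=> p [fp pg <-]; elim: p f fp pg => [f _ /cl_mx_inj ->|y p IH f] /=.
  by rewrite /potential big1 // => j _; rewrite /pot eqxx.
case/andP=> /asboolP adj yp pg; have [_ /vertex_cl[f' _ yE] _ _] := adj.
rewrite yE in adj yp pg; rewrite mulSn addnC.
exact: leq_trans (potential_step _ adj) (leq_add (IH _ yp pg) (leqnn _)).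
Qed.

Lemma potential_direct f g : (forall j, g j = f j \/ g j = tau (f j)) ->
  potential f g = (2 * #|moved f g|)%N.
Proof.
move=> fg; rewrite mulnC -sum_nat_const [RHS]big_mkcond; apply: eq_bigr => j _.
rewrite /pot finset.inE; have [-> | ] := fg j; first by rewrite eqxx.
by move=> ->; rewrite eqxx; case: eqP.
Qed.
End Potential.
End Connected.

(** * Shifting items along a permutation of the clusters *)

Section Shift.
Variables (n : nat) (kappa : 'I_n -> nat) (tau : 'I_n -> 'I_n) (q : 'I_n -> nat).
Local Notation m := (\sum_(i < n) kappa i)%N.
Hypothesis tau_inj : injective tau.
Hypothesis q_tau : forall a, q (tau a) = q a.
Hypothesis q_le : forall a, (q a <= kappa a)%N.

Definition start : {ffun 'I_m -> 'I_n} := [ffun j => tagnat.sig1 j].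

Definition target : {ffun 'I_m -> 'I_n} :=
  [ffun j => if (tagnat.sig2 j < q (start j))%N then tau (start j) else start j].

(** [start] and [tagnat.sig2] identify the items with the pairs of a cluster and a
    place in it. *)
Lemma sum_items (F : 'I_n -> nat -> nat) :
  (\sum_(j < m) F (start j) (tagnat.sig2 j) = \sum_a \sum_(r < kappa a) F a r)%N.
Proof.
rewrite sig_big_dep /= (reindex _ tagnat.sig_bij_on) /=.
by apply: eq_bigr => j _; rewrite ffunE.
Qed.

Lemma sum_threshold k t x y : (t <= k)%N ->
  (\sum_(r < k) (if r < t then x else y) = t * x + (k - t) * y)%N.
Proof.
move=> tk; rewrite -(big_mkord xpredT (fun r => if r < t then x else y))%N.
rewrite (big_cat_nat (n := t)) //=; congr addn.
  by rewrite (eq_big_nat _ _ (F2 := fun=> x)) ?sum_nat_const_nat ?subn0 // => i /andP[_ ->].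
rewrite (eq_big_nat _ _ (F2 := fun=> y)) ?sum_nat_const_nat // => i /andP[ti _].
by rewrite ltnNge ti.
Qed.

Lemma card_sum (I : finType) (P : pred I) : #|[set i | P i]| = (\sum_i P i)%N.
Proof. by rewrite -sum1_card big_mkcond; apply: eq_bigr => i _; rewrite inE; case: (P i). Qed.

Lemma clustering_start : clustering start.
Proof.
apply/forallP=> i; rewrite card_sum (sum_items (fun a _ => a == i)).
rewrite (bigD1 i) //= [X in (_ + X)%N]big1 ?addn0 => [|a /negPf ai].
  by rewrite eqxx sum_nat_const card_ord muln1.
by rewrite ai sum_nat_const muln0.
Qed.

(** Cluster [i] gives away [q i] items and receives as many from the preimage of
    [i], because [q] is constant along [tau]. *)
Lemma clustering_target : clustering target.
Proof.
apply/forallP=> i; rewrite card_sum.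
under eq_bigr => j _ do rewrite ffunE.
rewrite (sum_items (fun a r => (if (r < q a)%N then tau a else a) == i)).
rewrite (eq_bigr (fun a => q (tau a) * (tau a == i) + (kappa a - q a) * (a == i))%N).
  rewrite big_split /= -(reindex_inj tau_inj (P := xpredT) (F := fun a => q a * (a == i)))%N /=.
  rewrite -big_split (bigD1 i) //= big1 ?addn0 => [|a /negPf->]; last by rewrite !muln0.
  by rewrite eqxx !muln1 subnKC.
move=> a _; rewrite q_tau -(sum_threshold _ _ (q_le a)).
by apply: eq_bigr => r _; case: ifP.
Qed.

Lemma card_moved_target : (forall a, tau a != a) ->
  #|moved start target| = (\sum_a q a)%N.
Proof.
move=> tau_neq; rewrite card_sum.
under eq_bigr => j _ do rewrite [target j]ffunE.
rewrite (sum_items (fun a r => a != (if (r < q a)%N then tau a else a))).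
apply: eq_bigr => a _; rewrite -[RHS]muln1 -[RHS]addn0 -[X in (_ + X)%N](muln0 (kappa a - q a)%N).
rewrite -sum_threshold //; apply: eq_bigr => r _.
by case: ifP; rewrite ?eqxx // eq_sym tau_neq.
Qed.
End Shift.

(** * Rotating consecutive blocks *)

Section Blocks.
Variables (n : nat) (n4 : (4 <= n)%N).

(** Blocks are the pairs [2b, 2b + 1]; for odd [n] the minimum puts the last cluster
    in the last pair. *)
Definition block (a : nat) := minn a./2 (n./2).-1.

(** The successor within the block, the last element going back to the first, which
    is [2b]. *)
Definition cycle_next (a : nat) :=
  if (a.+1 < n)%N && (block a.+1 == block a) then a.+1 else (block a).*2.

(** Clusters are counted from zero here but sizes from one, so this is both the
    number of clusters up to the end of the block and the index of the size of
    its last, hence smallest, cluster. *)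
Definition block_top (a : nat) := if block a == (n./2).-1 then n else (block a).*2.+2.

Lemma block_subproof (a : 'I_n) : (block a < n./2)%N.
Proof. by have := ltn_ord a; rewrite /block; lia. Qed.

Lemma cycle_next_subproof (a : 'I_n) : (cycle_next a < n)%N.
Proof. by have := ltn_ord a; rewrite /cycle_next /block; case: ifP; lia. Qed.

Definition block_ord (a : 'I_n) : 'I_n./2 := Ordinal (block_subproof a).
Definition shift_ord (a : 'I_n) : 'I_n := Ordinal (cycle_next_subproof a).

Lemma shift_inj : injective shift_ord.
Proof.
move=> a b /(congr1 val) /= ab; apply: val_inj; move: ab (ltn_ord a) (ltn_ord b) => /=.
by rewrite /cycle_next /block; case: ifP; case: ifP; lia.
Qed.

Lemma shift_neq a : shift_ord a != a.
Proof.
rewrite -val_eqE /= /cycle_next /block; have := ltn_ord a; case: ifP; lia.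
Qed.

Lemma block_shift a : block_ord (shift_ord a) = block_ord a.
Proof.
apply: val_inj; rewrite /= /cycle_next /block; have := ltn_ord a; case: ifP; lia.
Qed.

Lemma card_block (b : 'I_n./2) : (0 < #|[set a | block_ord a == b]| <= 3)%N.
Proof.
have b_lt := ltn_ord b; apply/andP; split.
  have lt2b : (b.*2 < n)%N by lia.
  apply/card_gt0P; exists (Ordinal lt2b).
  by rewrite inE -val_eqE /= /block; lia.
pose pos (a : 'I_n) : 'I_3 := inord (a - b.*2).
rewrite -(@card_in_imset _ _ pos) => [|a a'].
  by rewrite -[leqRHS](card_ord 3) max_card.
rewrite !inE -!val_eqE /= /block => /eqP ab /eqP a'b /(congr1 val) /=.
have a_lt := ltn_ord a; have a'_lt := ltn_ord a'.
by rewrite !inordK; try lia; move=> ?; apply: val_inj => /=; lia.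
Qed.

End Blocks.

(** Each pair of clusters contributes twice the size of its second one, whose index
    is even. *)
Lemma sum_pairs (K : nat -> nat) h :
  (\sum_(0 <= a < h.*2) K (a./2).*2.+2 = \sum_(2 <= i < h.*2.+1 | ~~ odd i) 2 * K i)%N.
Proof.
have -> : (\sum_(2 <= i < h.*2.+1 | ~~ odd i) 2 * K i =
           \sum_(1 <= i < h.*2.+1 | ~~ odd i) 2 * K i)%N.
  by case: h => [|h]; [rewrite !big_geq | rewrite [RHS]big_ltn_cond].
rewrite [RHS]big_mkcond; elim: h => [|h IH]; first by rewrite !big_geq.
rewrite doubleS !(@big_nat_recr _ _ _ _ 0) //= [RHS]big_nat_recr //=.
rewrite [X in _ = (X + _)%N]big_nat_recr //= -IH.
rewrite odd_double uphalf_double half_double /=.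
by rewrite mul2n -addnn; lia.
Qed.

Lemma sum_tops_even (K : nat -> nat) n : (4 <= n)%N -> ~~ odd n ->
  (\sum_(a < n) K (block_top n a) = \sum_(2 <= i < n.+1 | ~~ odd i) 2 * K i)%N.
Proof.
move=> n4 n_even; have nE : n = (n./2).*2 by lia.
rewrite [in RHS]nE -sum_pairs -nE -(big_mkord xpredT (fun a => K (block_top n a))).
apply: eq_big_nat => a a_lt; congr K; rewrite /block_top /block.
case: ifP; lia.
Qed.

Lemma sum_tops_odd (K : nat -> nat) n : (4 <= n)%N -> odd n ->
  (\sum_(a < n) K (block_top n a) =
   \sum_(2 <= i < (n - 3).+1 | ~~ odd i) 2 * K i + 3 * K n)%N.
Proof.
move=> n4 n_odd; have nE : (n - 3 = ((n - 3)./2).*2)%N by lia.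
rewrite [in RHS]nE -sum_pairs -nE -(big_mkord xpredT (fun a => K (block_top n a))).
rewrite (big_cat_nat (n := (n - 3)%N)) ?leq_subr //=; congr addn.
  by apply: eq_big_nat => a a_lt; congr K; rewrite /block_top /block; case: ifP; lia.
rewrite (eq_big_nat _ _ (F2 := fun=> K n)) ?sum_nat_const_nat; first by congr muln; lia.
move=> a a_lt; congr K; rewrite /block_top /block; case: ifP; lia.
Qed.

(** * The lower bound on the diameter *)

Theorem lemma3p3 (R : realType) (n : nat) (kappa : nat -> nat)
    (hn : (4 <= n)%N)
    (hkappa : forall i : nat, (1 <= i < n)%N -> (kappa i.+1 <= kappa i)%N) :
  exists2 d : nat,
    diameter (@partition_polytope R n (fun i : 'I_n => kappa i.+1)) d &
    (~~ odd n ->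
       Num.ceil ((4 * (\sum_(2 <= i < n.+1 | ~~ odd i) 2 * kappa i)%N%:R)
                 / (3 * n%:R) : R) <= d%:Z) /\
    (odd n ->
       Num.ceil ((4 * (\sum_(2 <= i < (n - 3).+1 | ~~ odd i) 2 * kappa i
                       + 3 * kappa n)%N%:R)
                 / (3 * n%:R + 1) : R) <= d%:Z).
Proof.
pose kap (i : 'I_n) := kappa i.+1.
pose q (a : 'I_n) := kappa (block_top n a).
have kappa_anti i j : (1 <= i <= j)%N -> (j <= n)%N -> (kappa j <= kappa i)%N.
  case/andP=> i1; elim: j => [|j IH]; first by case: i i1.
  rewrite leq_eqVlt => /predU1P[->//|ij] jn.
  by apply: leq_trans (IH ij (ltnW jn)); apply: hkappa; rewrite jn (leq_trans i1).
have q_le a : (q a <= kap a)%N.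
  by apply: kappa_anti; have := ltn_ord a; rewrite /block_top /block; case: ifP; lia.
pose tau := shift_ord hn.
have q_tau a : q (tau a) = q a.
  by have /(congr1 val) /= := block_shift hn a; rewrite /q /block_top => ->.
have sC : clustering (start kap) by apply: clustering_start.
have tC : clustering (target kap tau q) by apply: clustering_target => //; apply: shift_inj.
have [d diam] := partition_diameter R sC; exists d => //.
have [_ dists] := diam.
have [k [/walk_potential wk _] kd] := dists _ _ (vertex_cl_mx R sC) (vertex_cl_mx R tC).
have := wk n./2 tau (block_ord hn) (@shift_inj _ hn) (shift_neq hn)
  (block_shift hn) (card_block hn).
rewrite potential_direct; last first.
  by move=> j; rewrite [target _ _ _ j]ffunE; case: ifP; [right|left].
rewrite card_moved_target //; last exact: shift_neq.
move=> /(_ ltac:(lia)) /leq_trans bound.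
have {}bound : (2 * \sum_a q a <= d * (2 * n - n./2))%N.
  by apply: bound; rewrite leq_mul2r kd orbT.
have natZ : d%:Z%:~R = d%:R :> R by [].
split=> n_par; rewrite ceil_le_int natZ ler_pdivrMr;
  try by rewrite ?ltr_wpDl // ?mulr_gt0 ?mulr_ge0 // ltr0n; lia.
- move: bound; rewrite sum_tops_even // -!natrM ler_nat; nia.
- move: bound; rewrite sum_tops_odd // -!natrM natr1 -natrM ler_nat; nia.
Qed.
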